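(* There exist constants $c>1$ and $\Delta_0$ such that for all integers $\Delta\ge\Delta_0$, $n\ge\Delta$ and $h\ge 2$ there exists a graded digraph $D$ with maximum degree $\Delta$ and with a graded partition $V(D)=V_1\cup\dots\cup V_h$ such that $|V_i|\le n$ for all $i\in\{1,\dots,h\}$ and $$\vec{r}(D) > c^{\Delta} h n \ge c^{\Delta}|V(D)|.$$
   Context: All digraphs are finite. A digraph $D$ is graded with graded partition $V(D)=V_1\cup\dots\cup V_h$ (a partition into disjoint parts) if every edge of $D$ is directed from $V_i$ to $V_{i+1}$ for some $i\in\{1,\dots,h-1\}$. Graded digraphs are acyclic. The maximum degree of a digraph is the maximum degree of its underlying undirected graph. A tournament on $N$ vertices is an orientation of the edges of the complete graph $K_N$. For an acyclic digraph $D$, the oriented Ramsey number $\vec{r}(D)$ is the minimum $N$ such that every tournament on $N$ vertices contains a copy of $D$, i.e. $D$ as a (not necessarily induced) subdigraph. *)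

(* Defs.v *)
From HB Require Import structures.
From mathcomp Require Import all_boot all_order all_algebra.
From mathcomp Require Import reals.

Set Implicit Arguments.
Unset Strict Implicit.
Unset Printing Implicit Defensive.

Record digraph := Digraph { vertex :> finType; edge : rel vertex }.

Definition is_tournament (T : digraph) : Prop :=
  irreflexive (@edge T) /\
  (forall x y : T, x != y -> edge x y = ~~ edge y x).

(* [T] contains a copy of [D], as a not necessarily induced subdigraph. *)
Definition contains_copy (T D : digraph) : Prop :=
  exists2 f : D -> T, injective f & forall u v : D, edge u v -> edge (f u) (f v).

Definition underlying_adj (D : digraph) : rel D :=
  fun u v => (u != v) && (edge u v || edge v u).

Definition max_degree (D : digraph) : nat :=
  \max_(v : D) #|[set w : D | underlying_adj v w]|.

(* The parts are indexed from 0, i.e. [V i] is the part usually written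
   V_{i+1}, and they are required to be nonempty. *)
Definition graded_partition (D : digraph) (h : nat) (V : 'I_h -> {set D}) : Prop :=
  [/\ forall i, V i != set0,
      forall i j, i != j -> [disjoint V i & V j],
      \bigcup_(i < h) V i = [set: D]
    & forall u v : D, edge u v ->
        exists i j : 'I_h, [/\ j = i.+1 :> nat, u \in V i & v \in V j]].

Definition every_tournament_contains (N : nat) (D : digraph) : Prop :=
  forall T : digraph, is_tournament T -> #|T| = N -> contains_copy T D.

(* [r] is the oriented Ramsey number of [D]. It is a relation because the minimum
   exists only for acyclic [D]. *)
Definition is_oriented_ramsey (D : digraph) (r : nat) : Prop :=
  every_tournament_contains r D /\
  (forall N : nat, every_tournament_contains N D -> r <= N).

(* Main.v *)
Require Import Defs.
From mathcomp Require Import all_boot all_order all_algebra.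
From mathcomp Require Import reals boolp zify ring lra.
Import Order.TTheory GRing.Theory Num.Theory.

Set Implicit Arguments.
Unset Strict Implicit.
Unset Printing Implicit Defensive.

(* Let R be a random tournament on k = 2^q vertices, where q is a small constant
   times Delta: between any two sets of t = O(q) vertices a constant proportion
   of the pairs points in each direction. Blow up the vertices of R by a factor
   s = Theta(n / q), and put h / 2 copies of the result in a transitive order.
   This tournament has exponentially many in Delta times h n vertices.

   Between consecutive layers of D put a union of O(q) random functions. Large
   sets X, Y of two such layers, coloured by the vertices of R with colour classes
   of size at most s, contain many disjoint rainbow t-sets, so a constant
   proportion of X * Y is mapped to backward pairs of R. A union bound over all
   k^O(n) colourings shows that some edge of D is always mapped to such a pair.

   In a copy of D in the tournament, the quartiles of the block indices of the
   layers are nondecreasing; unless half of two consecutive layers lie in the same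
   block, which the colouring property excludes, they increase by one every two
   layers, so that h / 2 blocks do not suffice. *)

(** * Subsets of prescribed size and the union bound *)

Lemma subset_of_card (T : finType) (A : {set T}) (t : nat) :
  t <= #|A| -> exists2 B : {set T}, B \subset A & #|B| = t.
Proof.
move=> tA; exists [set x in take t (enum A)].
  by apply/subsetP => x; rewrite inE => /mem_take; rewrite mem_enum.
rewrite cardsE; have /card_uniqP -> := take_uniq t (enum_uniq A).
by rewrite size_take -cardE; case: ltngtP tA.
Qed.

Lemma superset_of_card (T : finType) (A : {set T}) (t : nat) :
  #|A| <= t <= #|T| -> exists2 B : {set T}, A \subset B & #|B| = t.
Proof.
case/andP=> At tT.
have [|C CA Ct] := @subset_of_card T (~: A) (t - #|A|).
  by rewrite -(cardsC A) in tT; lia.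
exists (A :|: C); first exact: subsetUl.
rewrite cardsU Ct; suff -> : A :&: C = set0 by rewrite cards0; lia.
by apply/eqP; rewrite setI_eq0 disjoint_sym disjoints_subset.
Qed.

Lemma leq_card_bigcup (W G : finType) (F : W -> {set G}) :
  #|\bigcup_w F w| <= \sum_w #|F w|.
Proof.
elim/big_ind2: _ => [|A m B n Am Bn|//]; first by rewrite cards0.
by apply: leq_trans _ (leq_add Am Bn); apply: leq_card_setU.
Qed.

Lemma union_bound (W G : finType) (bad : W -> G -> bool) (M : nat) :
  0 < #|G| -> #|W| < M ->
  (forall w, #|[set g | bad w g]| * M <= #|G|) ->
  exists g, forall w, ~~ bad w g.
Proof.
move=> G0 WM badM; apply: contrapT => nex.
have cover : #|G| <= \sum_(w : W) #|[set g | bad w g]|.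
  rewrite -cardsT; apply: leq_trans _ (leq_card_bigcup (fun w => [set g | bad w g])).
  apply: subset_leq_card; apply/subsetP => g _; apply: contrapT => gN.
  apply: nex; exists g => w; apply/negP => bwg; apply: gN.
  by apply/bigcupP; exists w; rewrite ?inE.
have : #|G| * M <= #|W| * #|G|.
  apply: leq_trans (_ : \sum_(w : W) #|[set g | bad w g]| * M <= _).
    by rewrite -big_distrl leq_mul2r cover orbT.
  by rewrite -sum_nat_const; apply: leq_sum => w _; apply: badM.
by rewrite [#|W| * _]mulnC leq_pmul2l // leqNgt WM.
Qed.

(** * Rainbow sets in colourings with small classes *)

Lemma card_fibres_le (T C : finType) (c : T -> C) (s : nat) (X : {set T}) :
  (forall v, #|[set x in X | c x == v]| <= s) -> #|X| <= s * #|c @: X|.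
Proof.
move=> fib; rewrite -sum1_card (partition_big_imset c) /=.
rewrite mulnC -sum_nat_const; apply: leq_sum => v _.
by rewrite sum1dep_card.
Qed.

Lemma rainbow_subset (T C : finType) (c : T -> C) (t : nat) (X : {set T}) :
  t <= #|c @: X| ->
  exists A : {set T}, [/\ A \subset X, #|A| = t & {in A &, injective c}].
Proof.
move=> /subset_of_card[B BX Bt].
have repP v : v \in B -> exists x, (x \in X) && (c x == v).
  by move=> /(subsetP BX)/imsetP[x xX ->]; exists x; rewrite xX eqxx.
(* The choice of representatives needs a default point [x0], which exists once [t > 0]. *)
have [t0|t_gt0] := posnP t.
  by exists set0; rewrite sub0set cards0; split=> // x; rewrite inE.
have /card_gt0P[v0 /repP[x0 _]] : 0 < #|B| by rewrite Bt.
pose rep v := odflt x0 [pick x in X | c x == v].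
have repE v : v \in B -> rep v \in X /\ c (rep v) = v.
  move=> /repP[x xP]; rewrite /rep; case: pickP => [y /andP[yX /eqP]//|].
  by move/(_ x); rewrite xP.
exists (rep @: B); split.
- by apply/subsetP => _ /imsetP[v /repE[? _] ->].
- rewrite card_in_imset // => u v /repE[_ uE] /repE[_ vE] E.
  by rewrite -uE -vE E.
- move=> _ _ /imsetP[u /repE[_ uE] ->] /imsetP[v /repE[_ vE] ->].
  by rewrite uE vE => ->.
Qed.

(* Greedy extraction of [s] disjoint rainbow [t]-sets: as long as [s * t]
   points remain, they carry at least [t] colours. *)
Lemma rainbow_sum (T C : finType) (c : T -> C) (w : T -> nat) (s t W : nat)
    (X : {set T}) :
  (forall v, #|[set x in X | c x == v]| <= s) ->
  (forall A : {set T}, A \subset X -> #|A| = t -> {in A &, injective c} ->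
     W <= \sum_(x in A) w x) ->
  2 * s * t <= #|X| -> s * W <= \sum_(x in X) w x.
Proof.
have [-> //|s_gt0] := posnP s.
rewrite mul2n -addnn => fib sumA.
suff gen r (Y : {set T}) : Y \subset X -> (s + r) * t <= #|Y| ->
  r * W <= \sum_(x in Y) w x by apply: gen.
elim: r Y => [//|r IHr] Y YX Yge.
have tY : t <= #|c @: Y|.
  rewrite -(leq_pmul2l s_gt0).
  apply: leq_trans _ (card_fibres_le (c := c) (X := Y) _) => [|v].
    by apply: leq_trans _ Yge; rewrite leq_mul2r leq_addr orbT.
  apply: leq_trans _ (fib v); apply: subset_leq_card; apply/subsetP => x.
  by rewrite !inE => /andP[/(subsetP YX) -> ->].
have [A [AY At Ainj]] := rainbow_subset tY.
rewrite (big_setID A) /= (setIidPr AY) mulSn leq_add ?sumA //.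
  exact: subset_trans AY YX.
apply: IHr; first exact: subset_trans (subsetDl _ _) YX.
by rewrite cardsD (setIidPr AY) At; lia.
Qed.

(** * Chernoff bound and the random tournament *)

(** Rests on [2 ^ 9 <= 3 ^ 6]: each 8 units of [N] ask for 9 factors 2 and leave at least 6 factors
    3. The remainder [r < 8] is checked case by case. *)
Lemma pow3_ge_pow2 (N z : nat) : 4 * z <= N -> 2 ^ (N %/ 8 + N) <= 3 ^ (N - z).
Proof.
move=> zN; rewrite {1 2 3}(divn_eq N 8).
have r8 : N %% 8 < 8 by rewrite ltn_mod.
move: (divn_eq N 8) r8; move: (N %/ 8) (N %% 8) => p r NE r8.
apply: leq_trans (_ : 3 ^ (6 * p + (r - r %/ 4)) <= _); last first.
  by apply: leq_pexp2l => //; lia.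
have -> : ((p * 8 + r) %/ 8 + (p * 8 + r)) = 9 * p + r by lia.
rewrite [2 ^ _]expnD [3 ^ _]expnD leq_mul //.
  by case: p {NE} => [|p] //; rewrite (expnM 2) (expnM 3) leq_exp2r.
by clear NE; do 8 (case: r r8 => [//|r r8]).
Qed.

(* Exponential Markov inequality: weight [o] by 3 to the number of [p] in [P]
   with [o p != v]. *)
Lemma chernoff_bool (I : finType) (P : {set I}) (v : bool) :
  #|[set o : {ffun I -> bool} | 4 * #|[set p in P | o p == v]| <= #|P|]|
    * 2 ^ (#|P| %/ 8) <= 2 ^ #|I|.
Proof.
set E := [set o | _].
pose F p b := if p \in P then (if b == v then 1 else 3) else 1.
have FE (o : {ffun I -> bool}) :
    \prod_p F p (o p) = 3 ^ (#|P| - #|[set p in P | o p == v]|).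
  rewrite /F -big_mkcond /= (bigID (fun p => o p == v)) /=.
  rewrite big1 ?mul1n => [|p /andP[_ ->]//].
  rewrite (eq_bigr (fun=> 3)) => [|p /andP[_ /negPf->]//].
  rewrite prod_nat_const; congr (3 ^ _).
  rewrite -sum1_card -(cardsID [set p | o p == v] P).
  have -> : P :&: [set p | o p == v] = [set p in P | o p == v].
    by apply/setP => p; rewrite !inE.
  rewrite addKn -[RHS]sum1_card; apply: eq_bigl => p.
  by rewrite !inE andbC.
(* The total weight factorises: each [p] in [P] contributes [1 + 3 = 4], every other [p] contributes
   2. *)
have total : \sum_(o : {ffun I -> bool}) \prod_p F p (o p) = 2 ^ #|I| * 2 ^ #|P|.
  rewrite -bigA_distr_bigA /= (eq_bigr (fun p => 2 * (if p \in P then 2 else 1))).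
    by rewrite big_split /= -big_mkcond /= !prod_nat_const.
  move=> p _; rewrite big_bool /F; case: (p \in P) => //.
  by case: v {E FE F}.
have P2 : 0 < 2 ^ #|P| by rewrite expn_gt0.
rewrite -(leq_pmul2r P2) -total -mulnA -expnD.
rewrite -sum_nat_const.
apply: leq_trans (_ : \sum_(o in E) \prod_p F p (o p) <= _); last first.
  by rewrite [leqRHS](bigID (mem E)) /= leq_addr.
by apply: leq_sum => o; rewrite inE FE => /pow3_ge_pow2.
Qed.

(** The bit at [(i, j)] with [i < j] decides the pair [{i, j}], so a uniform [o] gives a uniform
    random tournament. *)
Definition orient (k : nat) (o : {ffun 'I_k * 'I_k -> bool}) : rel 'I_k :=
  fun i j => if i < j then o (i, j) else (j < i) && ~~ o (j, i).

Lemma orient_irr k (o : {ffun 'I_k * 'I_k -> bool}) : irreflexive (orient o).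
Proof. by move=> i; rewrite /orient ltnn. Qed.

Lemma orient_asym k (o : {ffun 'I_k * 'I_k -> bool}) (i j : 'I_k) :
  i != j -> orient o i j = ~~ orient o j i.
Proof. by rewrite -val_eqE /orient /=; case: ltngtP => //= _ _; rewrite negbK. Qed.

Lemma swap_pair_inj (T U : Type) : injective (fun p : T * U => (p.2, p.1)).
Proof. by move=> [x y] [x' y'] [-> ->]. Qed.

(** At most [t] pairs of [A * B] are diagonal, and swapping coordinates turns its descending pairs
    into the ascending pairs of [B * A]. *)
Lemma card_offdiag (k t : nat) (A B : {set 'I_k}) :
  #|A| = t -> #|B| = t ->
  t * t - t <= #|[set p in setX A B | p.1 < p.2]|
             + #|[set p in setX B A | p.1 < p.2]|.
Proof.
move=> At Bt; rewrite leq_subLR -{1}At -{1}Bt -cardsX.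
have -> : #|[set p in setX B A | p.1 < p.2]| = #|[set p in setX A B | p.2 < p.1]|.
  rewrite -(card_imset _ (@swap_pair_inj _ _)); apply: eq_card => p.
  apply/imsetP/idP => [[[i j]]|]; rewrite !inE /=.
    by move=> /andP[/andP[Bi Aj] ij] ->; rewrite /= Bi Aj.
  by case: p => i j /= /andP[/andP[Ai Bj] ij]; exists (j, i); rewrite ?inE ?Ai ?Bj.
have D : #|[set p in setX A B | p.1 == p.2]| <= t.
  rewrite -At -(card_in_imset (f := fst)) => [|[i j] [i' j']].
    by apply: subset_leq_card; apply/subsetP => _ /imsetP[[i j] /[!inE] /andP[/andP[Ai _] _] ->].
  by rewrite !inE /= => /andP[_ /eqP <-] /andP[_ /eqP <-] /= ->.
apply: leq_trans _ (leq_add D (leqnn _)).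
apply: leq_trans _ (leq_add (leqnn _) (leq_card_setU _ _)).
apply: leq_trans _ (leq_card_setU _ _); apply: subset_leq_card.
apply/subsetP => -[i j]; rewrite !inE /= => /andP[-> ->] /=.
by rewrite -val_eqE /=; case: ltngtP.
Qed.

(* Among the pairs of [A * B], those with [i < j] or those with [i > j] have
   distinct underlying edges and make up at least a quarter of [t ^ 2]. *)
Lemma quasirandom_tournament (q t k : nat) :
  0 < q -> 128 * q <= t -> k = 2 ^ q ->
  exists r : rel 'I_k,
    [/\ irreflexive r, forall i j, i != j -> r i j = ~~ r j i
      & forall A B : {set 'I_k}, #|A| = t -> #|B| = t ->
          t * t <= 16 * #|[set p in setX A B | r p.2 p.1]|].
Proof.
move=> q_gt0 qt kE; have t_gt1 : 1 < t by lia.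
have arith (a b N T : nat) : a <= b -> 16 * b < T -> T <= 4 * N -> 4 * a <= N.
  lia.
(* Sets of size [t] are listed by tuples, which bounds their number by [k ^ t]. *)
pose S (x : t.-tuple 'I_k) := [set i in x].
pose nbad o (A B : {set 'I_k}) := #|[set p in setX A B | orient o p.2 p.1]|.
pose bad (x : t.-tuple 'I_k * t.-tuple 'I_k) o :=
  [&& #|S x.1| == t, #|S x.2| == t & 16 * nbad o (S x.1) (S x.2) < t * t].
(* The exponent is the Chernoff exponent for at least [t * t / 4] pairs; it exceeds that of the
   [2 ^ (2 * q * t)] pairs of tuples because [128 * q <= t]. *)
have [||[A B]|o good] := @union_bound _ _ bad (2 ^ (t * t %/ 32)).
- by rewrite card_ffun card_bool expn_gt0.
- rewrite card_prod card_tuple card_ord kE -expnM -expnD ltn_exp2l //.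
  nia.
- rewrite card_ffun card_bool.
  have [/andP[/eqP At /eqP Bt]|nAB] := boolP ((#|S A| == t) && (#|S B| == t));
    last first.
    rewrite eq_card0 // => o; rewrite !inE /bad /= andbA.
    by rewrite (negPf nAB).
  have := card_offdiag At Bt.
  set P1 := [set p in _ | _]; set P2 := [set p in _ | _] => P12.
  have cut (P : {set 'I_k * 'I_k}) v : t * t <= 4 * #|P| ->
      (forall o : {ffun 'I_k * 'I_k -> bool}, #|[set p in P | o p == v]| <= nbad o (S A) (S B)) ->
      #|[set o | bad (A, B) o]| * 2 ^ (t * t %/ 32) <= 2 ^ #|{: 'I_k * 'I_k}|.
    move=> Pt Pbad; apply: leq_trans (chernoff_bool P v); apply: leq_mul.
      apply: subset_leq_card; apply/subsetP => o; rewrite !inE.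
      by move=> /and3P[_ _ bado]; apply: (arith _ _ _ _ (Pbad o) bado Pt).
    by rewrite leq_exp2l //; lia.
  have [P1t|P1t] := leqP (t * t) (4 * #|P1|).
    apply: (cut P1 false P1t) => o; apply: subset_leq_card.
    apply/subsetP => -[i j]; rewrite !inE /= => /andP[/andP[-> ij] /eqP oF].
    by rewrite /orient ij ltnNge (ltnW ij) oF.
  (* Here [t > 1] is used: [t * t - t] is at least half of [t * t]. *)
  have P2t : t * t <= 4 * #|P2| by nia.
  apply: (cut P2 true P2t) => o.
  rewrite -(card_imset _ (@swap_pair_inj _ _)); apply: subset_leq_card.
  apply/subsetP => _ /imsetP[[i j] /[!inE] /= /andP[/andP[/andP[Bi Aj] ij] /eqP oT] ->].
  by rewrite /= Bi Aj /orient ij oT.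
exists (orient o); split; [exact: orient_irr|exact: orient_asym|].
move=> A B At Bt.
have tup (C : {set 'I_k}) : #|C| = t -> exists x, S x = C.
  move=> Ct; have sC : size (enum C) == t by rewrite -cardE Ct.
  by exists (Tuple sC); apply/setP => i; rewrite inE mem_enum.
have [[x xA] [y yB]] := (tup A At, tup B Bt).
have := good (x, y); rewrite /bad /= xA yB At Bt eqxx /=.
by rewrite -leqNgt.
Qed.

(** * Random bipartite graphs against all colourings *)

(** This is [(1 - 1 / M) ^ M <= 1 / 2] for [M = m + 1], from two terms of the binomial expansion. *)
Lemma two_expn_pred (m : nat) : 2 * m ^ m.+1 <= m.+1 ^ m.+1.
Proof.
have bern j : m ^ j.+1 + j.+1 * m ^ j <= m.+1 ^ j.+1.
  elim: j => [|j IHj]; first by rewrite !expn1 expn0; lia.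
  rewrite (expnS m.+1); apply: leq_trans _ (leq_mul (leqnn _) IHj).
  by rewrite !expnS; nia.
by apply: leq_trans _ (bern m); rewrite expnS; nia.
Qed.

Lemma leq_AGM (I : finType) (E : I -> nat) :
  #|I| ^ #|I| * \prod_i E i <= (\sum_i E i) ^ #|I|.
Proof.
have := @leif_AGM_scaled int I predT (fun i => (E i)%:R%R) _.
case=> [i _|+ _]; first by rewrite mulrn_wge0.
rewrite (eq_bigr (fun i => (E i * #|I|)%:R%R)) => [|i _]; last first.
  by rewrite natrM mulr_natr.
rewrite -natr_prod -natr_sum -natrX ler_nat big_split /= prod_nat_const.
by rewrite mulnC.
Qed.

(** Each vertex draws [M * e] neighbours, so [B] is avoided with probability the [M * e]-th power of
    the product of all [free a / n]. By AM-GM that product is at most [(1 - 1 / M) ^ n], and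
    [(1 - 1 / M) ^ M <= 1 / 2] concludes. *)
Lemma card_avoiding (n M e : nat) (B : {set 'I_n * 'I_n}) :
  0 < n -> 1 < M -> n * n <= M * #|B| ->
  #|[set g : {ffun 'I_n * 'I_(M * e) -> 'I_n} | [forall p, (p.1, g p) \notin B]]|
    * 2 ^ (n * e) <= n ^ (n * (M * e)).
Proof.
move=> n_gt0; case: M => [|[|m]] // _; set M := m.+2 => BM.
pose free a := #|[set b | (a, b) \notin B]|.
have -> : #|[set g : {ffun 'I_n * 'I_(M * e) -> 'I_n}
              | [forall p, (p.1, g p) \notin B]]| = (\prod_a free a) ^ (M * e).
  pose F (p : 'I_n * 'I_(M * e)) := [pred b | (p.1, b) \notin B].
  rewrite (_ : #|_| = #|family F|); last first.
    apply: eq_card => g; rewrite inE; apply/forallP/familyP => gF p;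
      by have := gF p; rewrite inE.
  rewrite card_family foldrE big_map big_enum /=.
  rewrite -(pair_bigA _ (fun a j => #|F (a, j)|)) /=.
  rewrite (big_morph (expn^~ (M * e)) (fun x y => expnMn x y _) (exp1n _)).
  apply: eq_bigr => a _; rewrite (eq_bigr (fun=> free a)) => [|j _].
    by rewrite prod_nat_const card_ord.
  by rewrite /free cardsE.
have sumE : \sum_a free a + #|B| = n * n.
  have -> : #|B| = \sum_a #|[set b | (a, b) \in B]|.
    under eq_bigr do rewrite -sum1dep_card.
    by rewrite pair_big_dep /= sum1dep_card; apply: eq_card => -[a b]; rewrite inE.
  rewrite -big_split /= (eq_bigr (fun=> n)) => [|a _].
    by rewrite sum_nat_const card_ord.
  rewrite addnC -[RHS]card_ord -(cardsC [set b | (a, b) \in B]); congr (_ + _).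
  by apply: eq_card => b; rewrite !inE.
have agm : n ^ n * \prod_a free a <= (\sum_a free a) ^ n.
  by have := leq_AGM free; rewrite card_ord.
set Pi := \prod_a _ in agm *.
have base : M ^ n * Pi <= (m.+1 * n) ^ n.
  have nn : 0 < n ^ n by rewrite expn_gt0 n_gt0.
  rewrite -(leq_pmul2l nn) mulnCA -expnMn.
  apply: leq_trans (leq_mul (leqnn _) agm) _.
  by rewrite -expnMn leq_exp2r //; nia.
have m_gt0 : 0 < m.+1 ^ (n * (M * e)) by rewrite expn_gt0.
rewrite -(leq_pmul2l m_gt0) -expnMn (expnM (m.+1 * n)).
have [->|e_gt0] := posnP e; first by rewrite !muln0 !expn0.
apply: leq_trans _ (_ : (M ^ n * Pi) ^ (M * e) <= _); last first.
  by rewrite leq_exp2r // muln_gt0.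
rewrite expnMn mulnCA [leqRHS]mulnC leq_mul //.
have nMe : n * (M * e) = M * (n * e) by rewrite mulnCA.
rewrite -(expnM M) nMe !(expnM _ M) -expnMn leq_exp2r ?muln_gt0 ?n_gt0 //.
by rewrite mulnC two_expn_pred.
Qed.

Lemma card_pairs (S T : finType) (A : {set S}) (B : {set T}) (Q : S -> T -> bool) :
  #|[set p in setX A B | Q p.1 p.2]| = \sum_(x in A) \sum_(y in B) Q x y.
Proof.
rewrite pair_big /= -sum1dep_card big_mkcondr /=.
apply: eq_big => [[x y]|[x y] _]; first by rewrite in_setX.
by case: (Q x y).
Qed.

(** [rainbow_sum] is applied to [X] and then, for each rainbow [A], to [Y]. On two rainbow [t]-sets
    the colourings are injective, so the bound [W] transfers from [r]. *)
Lemma bad_pairs_ge (S T C : finType) (r : rel C) (s t W : nat)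
    (X : {set S}) (Y : {set T}) (c : S -> C) (c' : T -> C) :
  (forall A B : {set C}, #|A| = t -> #|B| = t ->
     W <= #|[set p in setX A B | r p.2 p.1]|) ->
  (forall v, #|[set x in X | c x == v]| <= s) ->
  (forall v, #|[set y in Y | c' y == v]| <= s) ->
  2 * s * t <= #|X| -> 2 * s * t <= #|Y| ->
  s * (s * W) <= #|[set p in setX X Y | r (c' p.2) (c p.1)]|.
Proof.
move=> rW fibX fibY Xs Ys.
rewrite (card_pairs X Y (fun x y => r (c' y) (c x))).
apply: (rainbow_sum fibX _ Xs) => A _ At cA; rewrite exchange_big /=.
apply: (rainbow_sum fibY _ Ys) => B _ Bt cB.
have := rW (c @: A) (c' @: B); rewrite !card_in_imset // => /(_ At Bt).
rewrite (card_pairs _ _ (fun i j => r j i)) big_imset //= exchange_big /=.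
by rewrite big_imset.
Qed.

(** Meant for parts [X], [Y] of consecutive layers mapped into one block, coloured by the vertices
    of [r] that they hit: some edge of [H] then runs against [r]. *)
Lemma random_bipartite (q t k M n s d : nat) (r : rel 'I_k) :
  0 < q -> k = 2 ^ q -> 0 < t -> 16 * t <= n -> s = n %/ (16 * t) ->
  16 * (32 * 32) <= M -> d = M * (8 * q) ->
  (forall A B : {set 'I_k}, #|A| = t -> #|B| = t ->
     t * t <= 16 * #|[set p in setX A B | r p.2 p.1]|) ->
  exists H : rel 'I_n,
    [/\ forall a, #|[set b | H a b]| <= d,
        forall b, #|[set a | H a b]| <= 8 * d
      & forall (X Y : {set 'I_n}) (c c' : {ffun 'I_n -> 'I_k}),
          n <= 4 * #|X| -> n <= 4 * #|Y| ->
          (forall v, #|[set x in X | c x == v]| <= s) ->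
          (forall v, #|[set y in Y | c' y == v]| <= s) ->
          exists a b, [/\ a \in X, b \in Y, H a b & r (c' b) (c a)]].
Proof.
move=> q_gt0 kE t_gt0 tn sE M_ge dE rt.
have st_le : 16 * s * t <= n.
  by rewrite sE mulnAC mulnC leq_trunc_div.
(* Since [16 * t <= n], rounding down in [s] loses at most a factor 2. *)
have st_ge : n <= 32 * (s * t).
  have t16 : 0 < 16 * t by rewrite muln_gt0.
  have s_gt0 : 0 < s by rewrite sE divn_gt0.
  have := ltn_ceil n t16; rewrite -sE; nia.
have n_gt0 : 0 < n by lia.
have M_gt1 : 1 < M by apply: leq_trans _ M_ge.
have d_gt0 : 0 < d by rewrite dE; nia.
(* Density 1/8, not the 1/4 of the conclusion, leaves room for deleting [n / 8] vertices of [Y]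
   later. *)
pose valid (w : {set 'I_n} * {set 'I_n} * {ffun 'I_n -> 'I_k} * {ffun 'I_n -> 'I_k}) :=
  let: (X, Y, c, c') := w in
  [&& n <= 8 * #|X|, n <= 8 * #|Y|,
      [forall v, #|[set x in X | c x == v]| <= s]
    & [forall v, #|[set y in Y | c' y == v]| <= s]].
pose Bd (w : {set 'I_n} * {set 'I_n} * {ffun 'I_n -> 'I_k} * {ffun 'I_n -> 'I_k}) :=
  let: (X, Y, c, c') := w in [set p in setX X Y | r (c' p.2) (c p.1)].
(* The density [1 / (16 * 32 ^ 2)] comes from [n <= 32 * s * t] and
   [(s * t) ^ 2 <= 16 * #|Bd w|]. *)
have BdP w : valid w -> n * n <= M * #|Bd w|.
  case: w => -[[X Y] c] c' /and4P[Xn Yn /forallP fX /forallP fY].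
  have rW (A B : {set 'I_k}) : #|A| = t -> #|B| = t ->
      (t * t + 15) %/ 16 <= #|[set p in setX A B | r p.2 p.1]|.
    by move=> At Bt; have := rt A B At Bt; lia.
  have Xs : 2 * s * t <= #|X| by lia.
  have Ys : 2 * s * t <= #|Y| by lia.
  have := bad_pairs_ge rW fX fY Xs Ys; set N := #|_| => N_ge.
  have N16 : (s * t) * (s * t) <= 16 * N.
    have tt : t * t <= 16 * ((t * t + 15) %/ 16) by lia.
    nia.
  apply: leq_trans (leq_mul st_ge st_ge) _.
  apply: leq_trans _ (leq_mul M_ge (leqnn _)).
  by rewrite mulnACA; nia.
pose bad w (g : {ffun 'I_n * 'I_(M * (8 * q)) -> 'I_n}) :=
  valid w && [forall p, (p.1, g p) \notin Bd w].
(* There are [2 ^ (2 * n + 2 * q * n)] tuples [w], fewer than [2 ^ (8 * q * n)]. *)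
have [||w|g good] := @union_bound _ _ bad (2 ^ (n * (8 * q))).
- by rewrite card_ffun card_ord expn_gt0 n_gt0.
- rewrite !card_prod card_ffun !card_ord kE -expnM.
  have -> : #|{set 'I_n}| = 2 ^ n.
    by rewrite -cardsT -powersetT card_powerset cardsT card_ord.
  by rewrite -!expnD ltn_exp2l //; nia.
- have [vw|nvw] := boolP (valid w); last first.
    by rewrite eq_card0 // => g; rewrite !inE /bad (negPf nvw).
  rewrite card_ffun card_prod !card_ord.
  apply: leq_trans _ (card_avoiding (8 * q) n_gt0 M_gt1 (BdP _ vw)).
  rewrite leq_mul2r; apply/orP; right.
  by apply: subset_leq_card; apply/subsetP => g; rewrite !inE => /andP[].
pose H0 a b := [exists j, g (a, j) == b].
have out0 a : #|[set b | H0 a b]| <= d.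
  have -> : [set b | H0 a b] = (fun j => g (a, j)) @: 'I_(M * (8 * q)).
    apply/setP => b; rewrite inE; apply/existsP/imsetP.
      by case=> j /eqP <-; exists j.
    by case=> j _ ->; exists j.
  by apply: leq_trans (leq_imset_card _ _) _; rewrite card_ord dE.
(* In-degrees are unbounded; discarding the edges into the few vertices of
   large in-degree removes at most [n / 8] vertices from [Y]. *)
pose high := [set b | 8 * d < #|[set a | H0 a b]|].
have high_le : 8 * #|high| <= n.
  rewrite -(leq_pmul2l d_gt0).
  apply: leq_trans (_ : \sum_b #|[set a | H0 a b]| <= _).
    rewrite mulnA [d * 8]mulnC mulnC -sum_nat_const.
    apply: leq_trans (_ : \sum_(b in high) #|[set a | H0 a b]| <= _).
      by apply: leq_sum => b; rewrite inE => /ltnW.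
    by rewrite [leqRHS](bigID (mem high)) /= leq_addr.
  under eq_bigr do rewrite -sum1dep_card big_mkcond.
  rewrite exchange_big /=.
  apply: leq_trans (_ : \sum_(a : 'I_n) d <= _).
    apply: leq_sum => a _; apply: leq_trans _ (out0 a).
    by rewrite -big_mkcond sum1dep_card.
  by rewrite sum_nat_const card_ord mulnC.
exists (fun a b => H0 a b && (b \notin high)); split.
- move=> a; apply: leq_trans _ (out0 a); apply: subset_leq_card.
  by apply/subsetP => b; rewrite !inE => /andP[].
- move=> b; have [bh|bh] := boolP (b \in high).
    by rewrite eq_card0 // => a; rewrite !inE andbF.
  apply: leq_trans (_ : #|[set a | H0 a b]| <= _).
    by apply: subset_leq_card; apply/subsetP => a; rewrite !inE => /andP[].
  by move: bh; rewrite inE -leqNgt.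
move=> X Y c c' Xn Yn fX fY.
have := good (X, Y :\: high, c, c'); rewrite /bad negb_and => /orP[/negP[]|].
  apply/and4P; split; [lia| |exact/forallP|].
    have : #|Y :&: high| <= #|high| by rewrite subset_leq_card ?subsetIr.
    rewrite -(cardsID high Y) in Yn; move: high_le Yn.
    move: #|high| #|_ :&: _| #|_ :\: _|; lia.
  apply/forallP => v; apply: leq_trans _ (fY v); apply: subset_leq_card.
  by apply/subsetP => y; rewrite !inE => /andP[/andP[_ ->] ->].
rewrite negb_forall => /existsP[[a j]]; rewrite negbK !inE /=.
move=> /andP[/and3P[aX bh bY] rba]; exists a, (g (a, j)); split=> //.
by rewrite inE bh andbT; apply/existsP; exists j.
Qed.

(** * Existence of oriented Ramsey numbers *)

(** The out- or the in-neighbourhood of [x] in [S] has at least [2 ^ N] vertices when [S] has twice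
    as many; recurse there and put [x] first or last. *)
Lemma transitive_subtournament (T : digraph) (N : nat) (S : {set T}) :
  is_tournament T -> 2 ^ N <= #|S| ->
  exists l : seq T, [/\ size l = N, {subset l <= S} & pairwise (@edge T) l].
Proof.
case=> _ tour; elim: N S => [|N IHN] S SN; first by exists [::].
have /card_gt0P[x xS] : 0 < #|S| by apply: leq_trans _ SN; rewrite expn_gt0.
pose O := [set y in S :\ x | edge x y]; pose I := [set y in S :\ x | edge y x].
have SOI : #|S| <= (#|O| + #|I|).+1.
  rewrite (cardsD1 x) xS add1n ltnS; apply: leq_trans _ (leq_card_setU _ _).
  apply: subset_leq_card; apply/subsetP => y; rewrite !inE => /andP[yx ->].
  by rewrite yx (tour _ _ yx) /= orbN.
have [ON|ON] := leqP (2 ^ N) #|O|.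
  have [l [lN lO pl]] := IHN _ ON.
  exists (x :: l); split; first by rewrite /= lN.
    by move=> y; rewrite inE => /predU1P[->//|/lO]; rewrite !inE => /andP[/andP[]].
  by rewrite pairwise_cons pl andbT; apply/allP => y /lO; rewrite !inE => /andP[].
have IN : 2 ^ N <= #|I| by rewrite expnS in SN; lia.
have [l [lN lI pl]] := IHN _ IN.
exists (rcons l x); split; first by rewrite size_rcons lN.
  move=> y; rewrite mem_rcons inE => /predU1P[->//|/lI].
  by rewrite !inE => /andP[/andP[]].
by rewrite pairwise_rcons pl andbT; apply/allP => y /lI; rewrite !inE => /andP[].
Qed.

Lemma every_tournament_contains_rank (D : digraph) (N : nat) (rk : D -> nat) :
  injective rk -> (forall u, rk u < N) -> (forall u v, edge u v -> rk u < rk v) ->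
  every_tournament_contains (2 ^ N) D.
Proof.
move=> rk_inj rkN rk_edge T tourT cT.
have [|l [lN _ pl]] := @transitive_subtournament T N [set: T] tourT.
  by rewrite cardsT cT.
have /card_gt0P[x0 _] : 0 < #|T| by rewrite cT expn_gt0.
move/(pairwiseP x0) in pl.
have ltl u v : rk u < rk v -> edge (nth x0 l (rk u)) (nth x0 l (rk v)).
  by move=> uv; apply: pl => //; rewrite inE lN.
exists (fun u => nth x0 l (rk u)); last by move=> u v /rk_edge/ltl.
move=> u v E; have [irrT _] := tourT.
by apply: rk_inj; case: (ltngtP (rk u) (rk v)) => // /ltl; rewrite E irrT.
Qed.

Lemma every_tournament_contains_leq (D : digraph) (N N' : nat) :
  N <= N' -> every_tournament_contains N D -> every_tournament_contains N' D.
Proof.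
move=> NN' ND T [irrT asymT] cT.
have [|S _ SN] := @subset_of_card T [set: T] N; first by rewrite cardsT cT.
pose U := Digraph (fun x y : {x : T | x \in S} => edge (val x) (val y)).
have [||f f_inj fE] := ND U.
- split=> [x|x y xy]; first exact: irrT.
  exact: asymT.
- by rewrite card_sig -SN; apply: eq_card.
- by exists (fun u => val (f u)) => [u v /val_inj/f_inj|].
Qed.

(** The first hypothesis makes the minimum exist; by monotonicity, one tournament on [N0] vertices
    without [D] bounds it from below. *)
Lemma oriented_ramsey_gt (D : digraph) (N N0 : nat) :
  every_tournament_contains N D -> ~ every_tournament_contains N0 D ->
  exists2 r, is_oriented_ramsey D r & N0 < r.
Proof.
move=> ND N0D.
have exN : exists N, `[< every_tournament_contains N D >] by exists N; apply/asboolP.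
case: (ex_minnP exN) => r /asboolP rD rmin; exists r.
  by split=> // N1 N1D; apply/rmin/asboolP.
by rewrite ltnNge; apply/negP => rN0; apply/N0D/(every_tournament_contains_leq rN0).
Qed.

(** * Layered digraphs and their degrees *)

(** [E i] joins layer [i] to layer [i + 1]. It depends on [i] so that the first layer can be altered
    to adjust the maximum degree. *)
Definition layered (n h : nat) (E : nat -> rel 'I_n) : digraph :=
  Digraph (fun u v : 'I_h * 'I_n => (v.1 == u.1.+1 :> nat) && E u.1 u.2 v.2).

Definition layer (n h : nat) (E : nat -> rel 'I_n) (i : 'I_h) :
  {set layered h E} := [set u | u.1 == i].

Lemma card_layer n h (E : nat -> rel 'I_n) (i : 'I_h) : #|layer E i| = n.
Proof.
rewrite -[RHS]card_ord -(card_in_imset (f := snd)).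
  apply: eq_card => a; rewrite [RHS]inE; apply/imsetP.
  by exists (i, a) => //; rewrite inE.
by move=> [j a] [j' b]; rewrite !inE /= => /eqP-> /eqP-> ->.
Qed.

Lemma layered_graded n h (E : nat -> rel 'I_n) :
  0 < n -> graded_partition (@layer n h E).
Proof.
move=> n_gt0; split.
- by move=> i; rewrite -card_gt0 card_layer.
- move=> i j ij; rewrite -setI_eq0; apply/eqP/setP => u; rewrite !inE.
  by apply/negP => /andP[/eqP ui /eqP uj]; rewrite -ui -uj eqxx in ij.
- by apply/setP => u; rewrite !inE; apply/bigcupP; exists u.1; rewrite ?inE.
- move=> u v /andP[/eqP uv _]; exists u.1, v.1.
  by rewrite !inE.
Qed.

Lemma layered_ramsey n h (E : nat -> rel 'I_n) :
  every_tournament_contains (2 ^ (h * n)) (layered h E).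
Proof.
apply: (@every_tournament_contains_rank (layered h E) (h * n)
  (fun u : 'I_h * 'I_n => u.1 * n + u.2)).
- move=> [i a] [j b] /= E1; have n_gt0 : 0 < n := leq_ltn_trans (leq0n a) (ltn_ord a).
  have := congr1 (divn^~ n) E1; rewrite !divnMDl // !divn_small // !addn0 => /val_inj ij.
  by move: E1; rewrite ij => /addnI/val_inj ->.
- move=> [i a] /=; apply: leq_trans (_ : i.+1 * n <= _).
    by rewrite mulSn addnC ltn_add2r.
  by rewrite leq_mul2r ltn_ord orbT.
- move=> [i a] [j b] /andP[/= /eqP -> _].
  by rewrite mulSn; have := ltn_ord a; lia.
Qed.

(** The vertex [a0] of layer 0 has no in-neighbours, hence degree [#|S|]. Any other vertex has
    out-degree at most [d] and in-degree at most [8 * d + 1], the 1 paying for an extra edge from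
    [a0]. *)
Lemma layered_max_degree n h (H : rel 'I_n) (a0 : 'I_n) (S : {set 'I_n}) (d : nat) :
  2 <= h -> (forall a, #|[set b | H a b]| <= d) ->
  (forall b, #|[set a | H a b]| <= 8 * d) -> (9 * d).+1 <= #|S| ->
  max_degree (layered h (fun i a b => if (i == 0) && (a == a0) then b \in S
                                      else H a b)) = #|S|.
Proof.
move=> h2 Hout Hin dS; set E := fun i a b => _; rewrite /max_degree.
pose out (v : 'I_h * 'I_n) := [set w : 'I_h * 'I_n | (w.1 == v.1.+1 :> nat) && E v.1 v.2 w.2].
pose inn (v : 'I_h * 'I_n) := [set w : 'I_h * 'I_n | (v.1 == w.1.+1 :> nat) && E w.1 w.2 v.2].
have nbrs (v : layered h E) : [set w | underlying_adj v w] = out v :|: inn v.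
  apply/setP => w; rewrite !inE /underlying_adj /=.
  apply: andb_idl => /orP[] /andP[/eqP vw _]; apply/eqP => E1;
    by move: vw; rewrite E1; lia.
have fib (A : {set 'I_h * 'I_n}) (B : {set 'I_n}) :
    {in A &, forall u v, u.1 = v.1} -> {in A, forall u, u.2 \in B} -> #|A| <= #|B|.
  move=> A1 A2; rewrite -(card_in_imset (f := snd) (D := mem A)).
    by apply: subset_leq_card; apply/subsetP => _ /imsetP[u uA ->]; apply: A2.
  by move=> [i a] [j b] uA vA /= ab; have /= -> := A1 _ _ uA vA; rewrite ab.
have out1 v : {in out v &, forall u w, u.1 = w.1}.
  move=> u w; rewrite !inE => /andP[/eqP u1 _] /andP[/eqP w1 _].
  by apply: val_inj; rewrite /= u1 w1.
have inn1 v : {in inn v &, forall u w, u.1 = w.1}.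
  move=> u w; rewrite !inE => /andP[/eqP u1 _] /andP[/eqP w1 _].
  by apply: val_inj; apply: succn_inj; rewrite /= -u1 -w1.
have innB v : #|inn v| <= (8 * d).+1.
  apply: leq_trans (_ : #|a0 |: [set a | H a v.2]| <= _).
    apply: fib (inn1 v) _ => w; rewrite !inE /E => /andP[_].
    by case: ifP => [/andP[_ ->]//|_ ->]; rewrite orbT.
  by rewrite cardsU1 -add1n leq_add // leq_b1.
apply/eqP; rewrite eqn_leq; apply/andP; split.
  apply/bigmax_leqP => v _; rewrite nbrs; apply: leq_trans (leq_card_setU _ _) _.
  have [v0|v0] := boolP ((v.1 == 0 :> nat) && (v.2 == a0)).
    rewrite [#|inn v|]eq_card0 => [|w]; last first.
      by rewrite !inE; case/andP: v0 => /eqP ->.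
    rewrite addn0; apply: fib (out1 v) _ => w; rewrite !inE /E v0.
    by case/andP.
  have ov : #|out v| <= d.
    apply: leq_trans _ (Hout v.2); apply: fib (out1 v) _ => w.
    by rewrite !inE /E (negPf v0) => /andP[].
  apply: leq_trans (leq_add ov (innB v)) _; apply: leq_trans _ dS; lia.
have h0 : 0 < h by lia.
pose v0 : layered h E := (Ordinal h0, a0).
apply: leq_trans _ (leq_bigmax v0).
rewrite nbrs; apply: leq_trans _ (subset_leq_card (subsetUl _ _)).
rewrite -(card_imset (f := fun b => (Ordinal h2, b))); last by move=> ? ? [].
apply: subset_leq_card; apply/subsetP => _ /imsetP[b bS ->].
by rewrite !inE /E /= !eqxx.
Qed.

(** * The blown-up tournament contains no copy *)

(* A transitive tournament on ['I_m], each vertex of which is replaced by a copy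
   of [r], each vertex of which is replaced by a transitive tournament on ['I_s]. *)
Definition blowup (m k s : nat) (r : rel 'I_k) : digraph :=
  Digraph (fun x y : 'I_m * 'I_k * 'I_s =>
    if x.1.1 != y.1.1 then x.1.1 < y.1.1
    else if x.1.2 != y.1.2 then r x.1.2 y.1.2 else x.2 < y.2).

Lemma blowup_tournament m k s (r : rel 'I_k) :
  (forall i j, i != j -> r i j = ~~ r j i) -> is_tournament (blowup m s r).
Proof.
move=> asym; split=> [[[b i] x]|[[b i] x] [[b' i'] x']]; rewrite /edge /=.
  by rewrite !eqxx /= ltnn.
have lt_asym (N : nat) (u v : 'I_N) : u != v -> (u < v) = ~~ (v < u).
  by rewrite -val_eqE /=; case: ltngtP.
rewrite !xpair_eqE (eq_sym b' b) (eq_sym i' i).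
have [_|nb _] := eqVneq b b'; last exact: lt_asym.
by have [_|ni _] := eqVneq i i'; rewrite /=; [apply: lt_asym|apply: asym].
Qed.

Lemma layered_not_in_blowup (n h k s : nat) (H : rel 'I_n) (r : rel 'I_k)
    (E : nat -> rel 'I_n) :
  0 < n -> 2 <= h -> n <= k * s -> irreflexive r ->
  (forall i j, i != j -> r i j = ~~ r j i) ->
  (forall i a b, H a b -> E i a b) ->
  (forall (X Y : {set 'I_n}) (c c' : {ffun 'I_n -> 'I_k}),
      n <= 4 * #|X| -> n <= 4 * #|Y| ->
      (forall v, #|[set x in X | c x == v]| <= s) ->
      (forall v, #|[set y in Y | c' y == v]| <= s) ->
      exists a b, [/\ a \in X, b \in Y, H a b & r (c' b) (c a)]) ->
  ~ contains_copy (blowup h./2 s r) (layered h E).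
Proof.
move=> n_gt0 h2 nks irr asym HE Hprop [f f_inj fE].
have s_gt0 : 0 < s by case: s nks {f f_inj fE Hprop}; lia.
(* Colouring [a] by [a %/ s] has classes of size at most [s] and fits into [k] colours as
   [n <= k * s]; so [Hprop] also yields plain expansion. *)
have expand (X Y : {set 'I_n}) : n <= 4 * #|X| -> n <= 4 * #|Y| ->
    exists a b, [/\ a \in X, b \in Y & H a b].
  move=> Xn Yn.
  have lt_k (a : 'I_n) : a %/ s < k.
    by rewrite ltn_divLR //; apply: leq_trans nks.
  pose c := [ffun a : 'I_n => Ordinal (lt_k a)].
  have cfib (Z : {set 'I_n}) v : #|[set x in Z | c x == v]| <= s.
    rewrite -[leqRHS]card_ord.
    rewrite -(card_in_imset (f := fun a : 'I_n => Ordinal (ltn_pmod a s_gt0))).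
      exact: max_card.
    move=> a b; rewrite !inE !ffunE => /andP[_ /eqP av] /andP[_ /eqP bv] [ab].
    apply: val_inj; rewrite /= (divn_eq a s) (divn_eq b s) ab.
    by have [->] : Ordinal (lt_k a) = Ordinal (lt_k b) by rewrite av bv.
  have [a [b [aX bY Hab _]]] := Hprop X Y c c Xn Yn (cfib X) (cfib Y).
  by exists a, b.
have m_gt0 : 0 < h./2 by rewrite half_gt0.
have h_gt0 : 0 < h by lia.
pose o i := odflt (Ordinal h_gt0) (insub i).
have oE i : i < h -> val (o i) = i by move=> ih; rewrite /o insubT.
pose blk i a : nat := (f (o i, a)).1.1.
pose col i := [ffun a => (f (o i, a)).1.2].
have edgeE i a b : i.+1 < h -> H a b -> edge (f (o i, a)) (f (o i.+1, b)).
  move=> ih Hab; apply: fE; rewrite /edge /= !oE ?eqxx ?HE //; lia.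
have blkE i a b : i.+1 < h -> H a b -> blk i a <= blk i.+1 b.
  move=> ih /(edgeE _ _ _ ih); rewrite /edge /= /blk.
  by case: eqVneq => [->//|_ /ltnW].
(* [P i u]: the upper quartile of the block indices of layer [i] is at least
   [u]; [Q i u]: the lower quartile is. *)
pose P i u := n <= 4 * #|[set a | u <= blk i a]|.
pose Q i u := 4 * #|[set a | blk i a < u]| < n.
have compl i u : #|[set a | u <= blk i a]| + #|[set a | blk i a < u]| = n.
  rewrite -[RHS]card_ord -(cardsC [set a | u <= blk i a]); congr (_ + _).
  by apply: eq_card => a; rewrite !inE ltnNge.
(* Otherwise expansion gives an edge from a block at least [u] to a block below [u]. *)
have PQ i u : i.+1 < h -> P i u -> Q i.+1 u.
  move=> ih Piu; rewrite /Q ltnNge; apply/negP => Qn.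
  have [a [b []]] := expand _ _ Piu Qn; rewrite !inE => ua bu Hab.
  by have := blkE _ _ _ ih Hab; lia.
have QP i u : Q i u -> P i u.
  by rewrite /Q /P => Qi; have := compl i u; lia.
have heavy i u : Q i u -> ~~ P i u.+1 -> n <= 4 * #|[set a | blk i a == u]|.
  rewrite /P -ltnNge => Qi Pi.
  have : #|[set a | u <= blk i a]| <=
         #|[set a | blk i a == u]| + #|[set a | u < blk i a]|.
    apply: leq_trans _ (leq_card_setU _ _); apply: subset_leq_card.
    by apply/subsetP => a; rewrite !inE; case: ltngtP.
  move: (compl i u) Pi Qi; rewrite /Q; lia.
have step i u : i.+1 < h -> Q i u -> P i.+1 u.+1.
  move=> ih Qi.
  have [Pi|nPi] := boolP (P i u.+1); first by apply/QP/PQ.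
  (* Otherwise both layers are heavy in block [u]. Coloured by vertices of [r], they have classes of
     size at most [s] by injectivity of [f], and [Hprop] gives an edge mapped backwards. *)
  apply: contrapT => /negP nPi1.
  have Xn := heavy _ _ Qi nPi.
  have Yn := heavy _ _ (PQ _ _ ih (QP _ _ Qi)) nPi1.
  have fib j v : #|[set x in [set a | blk j a == u] | col j x == v]| <= s.
    rewrite -[leqRHS]card_ord.
    rewrite -(card_in_imset (f := fun a => (f (o j, a)).2)); first exact: max_card.
    move=> a b; rewrite !inE !ffunE => /andP[/eqP au /eqP av] /andP[/eqP bu /eqP bv] ab.
    suff /f_inj[//] : f (o j, a) = f (o j, b).
    move: au av bu bv ab; rewrite /blk.
    case: (f (o j, a)) => -[x1 x2] x3; case: (f (o j, b)) => -[y1 y2] y3 /= xu -> yu -> ->.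
    by congr (_, _, _); apply: val_inj; rewrite /= xu yu.
  have [a [b []]] := Hprop _ _ _ _ Xn Yn (fib i) (fib i.+1).
  rewrite !inE !ffunE => /eqP au /eqP bu Hab rba.
  have := edgeE _ _ _ ih Hab; rewrite /edge /=.
  have -> : (f (o i, a)).1.1 = (f (o i.+1, b)).1.1.
    by apply: val_inj; rewrite /= -[LHS]/(blk i a) au -[RHS]/(blk i.+1 b) bu.
  rewrite eqxx /=; case: eqVneq => [ab|nab].
    by rewrite ab irr in rba.
  by rewrite (asym _ _ nab) rba.
have climb j : j.*2.+1 < h -> P j.*2.+1 j.+1.
  elim: j => [|j IHj] jh.
    by apply: step => //; rewrite /Q eq_card0 // => a; rewrite !inE.
  rewrite doubleS; apply: step; first by rewrite -doubleS.
  by apply: PQ; [|apply: IHj]; rewrite doubleS in jh; lia.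
(* Layer [2 * (h / 2) - 1] would reach block index [h / 2], but the indices stop at [h / 2 - 1]. *)
have hh : h./2.-1.*2.+1 < h by lia.
have := climb _ hh; rewrite prednK // /P eq_card0 => [|a].
  by rewrite muln0 leqNgt n_gt0.
by rewrite !inE /blk leqNgt ltn_ord.
Qed.

(** * Choice of the integer parameters *)

(** Serves to absorb the factor [2 ^ 14 * q] lost in the construction into half of the exponent. *)
Lemma sqr_linear_leq_expn q : 64 <= q -> (2 ^ 14 * q) ^ 2 <= 2 ^ q.
Proof.
elim: q => [//|q IHq]; rewrite leq_eqVlt => /predU1P[<-|].
  by rewrite -[X in _ * X]/(2 ^ 6) -expnD -expnM leq_exp2l.
rewrite ltnS => q64; have := IHq q64.
move: (2 ^ 14) => C CqE; rewrite (expnS 2 q); apply: leq_trans _ (leq_mul (leqnn 2) CqE).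
by rewrite !expnMn mulnCA leq_mul2l; apply/orP; right; rewrite -!mulnn; nia.
Qed.

Lemma graded_digraph_with_large_ramsey :
  exists2 K, 0 < K & forall q n h Delta,
    64 <= q -> K * q <= Delta -> Delta <= n -> 2 <= h ->
    exists (D : digraph) (V : 'I_h -> {set D}) (r : nat),
      [/\ max_degree D = Delta, graded_partition V, forall i, #|V i| = n,
          is_oriented_ramsey D r & #|D| = h * n /\ h * n * 2 ^ q < 2 ^ 14 * q * r].
Proof.
have [M M_ge] : exists M, 16 * (32 * 32) <= M by exists (16 * (32 * 32)).
(* The first term gives [9 * d + 1 <= Delta], as [9 * d = 72 * M * q]; the second gives
   [16 * t <= n]. *)
exists (73 * M + 16 * 128); first by rewrite addn_gt0 orbT.
move=> q n h Delta q64 Kq Dn h2.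
have q_gt0 : 0 < q by lia.
have M_gt0 : 0 < M by apply: leq_trans _ M_ge.
pose k := 2 ^ q; pose t := 128 * q; pose s := n %/ (16 * t); pose d := M * (8 * q).
have dD : (9 * d).+1 <= Delta by rewrite /d; nia.
have tn : 16 * t <= n by rewrite /t; nia.
have t_gt0 : 0 < t by rewrite /t; lia.
have [r [irr asym rt]] := @quasirandom_tournament q t k q_gt0 (leqnn _) erefl.
have [H [Hout Hin Hprop]] := @random_bipartite q t k M n s d r q_gt0 erefl t_gt0 tn
  erefl M_ge erefl rt.
have n_gt0 : 0 < n by lia.
have nts : n <= 32 * (t * s).
  have t16 : 0 < 16 * t by lia.
  have s_gt0 : 0 < s by rewrite divn_gt0.
  by have := ltn_ceil n t16; rewrite -/s; nia.
have q_lt := sqr_linear_leq_expn q64.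
have Cq : 2 ^ 14 * q <= k by rewrite /k; move: (2 ^ 14) (2 ^ q) q_lt => C N; nia.
have C_eq : 2 ^ 14 = 4 * (32 * 128) by [].
have nks : n <= k * s.
  rewrite C_eq in Cq; rewrite /t in nts; nia.
pose a0 := Ordinal n_gt0.
(* Enlarging the out-neighbourhood of [a0] to [Delta] vertices, possible as [Delta <= n], makes the
   maximum degree exact. *)
have [|S HS SD] := @superset_of_card _ [set b | H a0 b] Delta.
  by rewrite card_ord Dn andbT; apply: leq_trans (Hout a0) _; lia.
pose E (i : nat) a b := if (i == 0) && (a == a0) then b \in S else H a b.
have HE i a b : H a b -> E i a b.
  rewrite /E; case: ifP => // /andP[_ /eqP ->] Hb.
  by apply: (subsetP HS); rewrite inE.
have nocopy := layered_not_in_blowup n_gt0 h2 nks irr asym HE Hprop.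
have [|rr rrP rr_gt] := @oriented_ramsey_gt (layered h E) _ (h./2 * k * s)
    (@layered_ramsey n h E).
  move=> all; apply/nocopy/all; first exact: blowup_tournament.
  by rewrite /= !card_prod !card_ord.
exists (layered h E), (@layer n h E), rr; split=> //.
- by rewrite (layered_max_degree a0 h2 Hout Hin) ?SD.
- exact: layered_graded.
- exact: card_layer.
split; first by rewrite card_prod !card_ord.
(* [2 ^ 14 * q] is [4 * 32 * t]: the 4 covers halving and rounding [h], and [32 * t] covers
   [n / s]. *)
have hn : h * n <= 2 ^ 14 * q * (h./2 * s).
  rewrite C_eq; apply: leq_trans (leq_mul (_ : h <= 4 * h./2) nts) _; first by lia.
  by rewrite /t; lia.
apply: leq_ltn_trans (leq_mul hn (leqnn _)) _; rewrite -/k -mulnA ltn_pmul2l.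
  by rewrite mulnAC.
by rewrite muln_gt0 q_gt0 expn_gt0.
Qed.

(** * Passage to a real base *)

Local Open Scope ring_scope.

(** Take [c = 1 / (1 - x)] with [x = 1 / (2 * N)]; Bernoulli gives [(1 - x) ^ N >= 1 / 2]. *)
Lemma exists_small_base (R : realType) (N : nat) :
  (0 < N)%N -> exists2 c : R, 1 < c & c ^+ N <= 2.
Proof.
move=> N_gt0; pose x : R := (2 * N)%:R^-1.
have x_gt0 : 0 < x by rewrite invr_gt0 ltr0n muln_gt0.
have Nx : N%:R * x = 2^-1.
  have N_neq0 : N%:R != 0 :> R by rewrite pnatr_eq0 -lt0n.
  by rewrite /x natrM; field.
have x_lt1 : x < 1.
  by rewrite invf_lt1 ?ltr0n ?muln_gt0 // ltr1n; lia.
have bern j : 1 - j%:R * x <= (1 - x) ^+ j.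
  elim: j => [|j IHj]; first by rewrite mul0r subr0 expr0.
  have x1 : 0 <= 1 - x by lra.
  rewrite exprS; apply: le_trans _ (ler_wpM2l x1 IHj).
  have : 0 <= j%:R * (x * x) by rewrite !mulr_ge0 // ltW.
  by rewrite -natr1; lra.
exists (1 - x)^-1; first by rewrite invf_gt1; lra.
rewrite exprVn -[leRHS]invrK lef_pV2 ?posrE ?invr_gt0 ?exprn_gt0 //; last by lra.
by have := bern N; rewrite Nx; lra.
Qed.

Theorem theorem1p6 (R : realType) :
  exists (c : R) (Delta0 : nat), 1 < c /\
    forall Delta n h : nat,
      (Delta0 <= Delta)%N -> (Delta <= n)%N -> (2 <= h)%N ->
      exists (D : digraph) (V : 'I_h -> {set D}) (r : nat),
        [/\ max_degree D = Delta,
            graded_partition V,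
            (forall i : 'I_h, (#|V i| <= n)%N),
            is_oriented_ramsey D r
          & c ^+ Delta * h%:R * n%:R < r%:R /\
            c ^+ Delta * #|D|%:R <= c ^+ Delta * h%:R * n%:R].
Proof.
have [K K_gt0 lower] := graded_digraph_with_large_ramsey.
(* As [Delta < K * (q + 1) <= 2 * K * q], the exponent [4 * K] yields [c ^ (2 * Delta) <= 2 ^ q]. *)
have [|c c_gt1 cK] := @exists_small_base R (4 * K); first by rewrite muln_gt0.
exists c, (K * 64)%N; split=> // Delta n h DeltaK Dn h2.
have c_gt0 : 0 < c by apply: lt_trans c_gt1.
pose q := (Delta %/ K)%N.
have q64 : (64 <= q)%N by rewrite leq_divRL // mulnC.
have Kq : (K * q <= Delta)%N by rewrite mulnC leq_trunc_div.
have [D [V [r [degD gradV cardV ramD [cardD hnr]]]]] := lower q n h Delta q64 Kq Dn h2.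
exists D, V, r; split=> // [i|]; first by rewrite cardV.
split; last by rewrite cardD natrM mulrA.
have cD : c ^+ Delta * c ^+ Delta <= (2 ^ q)%:R.
  rewrite -exprD natrX; apply: le_trans (_ : c ^+ (4 * K * q) <= _).
    apply: ler_weXn2l; first exact: ltW.
    by have := ltn_ceil Delta K_gt0; rewrite -/q; nia.
  by rewrite exprM lerXn2r // nnegrE ?exprn_ge0 ?ltW // ltW.
set C := (2 ^ 14 * q)%N in hnr.
have C_gt0 : 0 < C%:R :> R by rewrite ltr0n muln_gt0 expn_gt0 /=; lia.
(* Both factors have square at most [2 ^ q]. *)
have cC : c ^+ Delta * C%:R <= (2 ^ q)%:R.
  have P_ge0 : 0 <= c ^+ Delta by rewrite exprn_ge0 ?ltW.
  have C2 : C%:R * C%:R <= (2 ^ q)%:R :> R.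
    by rewrite -natrM ler_nat mulnn sqr_linear_leq_expn.
  have Q_ge0 : 0 <= (2 ^ q)%:R :> R by apply: ler0n.
  have PC_ge0 : 0 <= c ^+ Delta * C%:R by rewrite mulr_ge0 // ltW.
  rewrite -(@ler_pXn2r _ 2) ?nnegrE // !expr2 mulrACA.
  by apply: ler_pM => //; rewrite mulr_ge0 // ltW.
rewrite -(ltr_pM2l C_gt0) -natrM.
apply: le_lt_trans (_ : (h * n * 2 ^ q)%:R < _); last by rewrite ltr_nat.
have hn_ge0 : 0 <= (h * n)%:R :> R by apply: ler0n.
rewrite natrM; apply: le_trans (_ : (h * n)%:R * (c ^+ Delta * C%:R) <= _).
  by rewrite natrM; lra.
exact: ler_wpM2l.
Qed.
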